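(* There is a constant $C>0$ such that for all $n\ge 3$, $$\mathrm{ex}_\circlearrowright(n,D_2)\ge\frac37\binom n2-Cn.$$
   Context: $\Omega_n=\{v_0,\dots,v_{n-1}\}$ is the vertex set of a regular $n$-gon with the clockwise cyclic ordering. We write $x_1<x_2<\dots<x_k<x_1$ to mean that $x_1,\dots,x_k$ are distinct and occur in this clockwise cyclic order. A convex geometric hypergraph (cgh) on $\Omega_n$ is a set $H$ of $3$-element subsets (edges) of $\Omega_n$. A cgh $H$ contains a cgh $F$ if there is an injection from the vertex set of $F$ to the vertex set of $H$ preserving the cyclic ordering and mapping edges to edges; otherwise $H$ is $F$-free. $\mathrm{ex}_\circlearrowright(n,F)$ is the maximum number of edges in an $F$-free cgh on $\Omega_n$. $D_2$ is the cgh with two edges $\{x_1,x_2,x_3\},\{x_1,x_2,x_4\}$, where $x_1<x_2<x_3<x_4<x_1$ (two distinct triangles sharing a side and lying on the same side of it). *)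

(* Defs.v *)
From mathcomp Require Import all_boot.

Set Implicit Arguments.
Unset Strict Implicit.
Unset Printing Implicit Defensive.

(* The vertex v_i of the regular n-gon is i : 'I_n, numbered clockwise, so
   x_1 < x_2 < ... < x_k < x_1 holds iff some rotation of the sequence
   x_1, ..., x_k is strictly increasing for the numbering. *)
Definition cyc_lt n (s : seq 'I_n) : bool :=
  [exists k : 'I_(size s).+1,
     sorted ltn [seq nat_of_ord x | x <- rot k s]].

Definition is_cgh n (H : {set {set 'I_n}}) : bool :=
  [forall e in H, #|e| == 3].

(* A cyclic ordering is determined by its restriction to triples. *)
Definition cyc_preserving m n (f : 'I_m -> 'I_n) : bool :=
  [forall x, forall y, forall z,
     cyc_lt [:: x; y; z] ==> cyc_lt [:: f x; f y; f z]].

Definition cgh_contains m n (H : {set {set 'I_n}}) (F : {set {set 'I_m}}) : bool :=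
  [exists f : {ffun 'I_m -> 'I_n},
     [&& injectiveb f, cyc_preserving f & [forall e in F, f @: e \in H]]].

Definition cgh_free m n (F : {set {set 'I_m}}) (H : {set {set 'I_n}}) : bool :=
  ~~ cgh_contains H F.

Definition ex_cgh m (n : nat) (F : {set {set 'I_m}}) : nat :=
  \max_(H : {set {set 'I_n}} | is_cgh H && cgh_free F H) #|H|.

(* The vertices x_1 < x_2 < x_3 < x_4 < x_1 are 0, 1, 2, 3 : 'I_4. *)
Definition D2 : {set {set 'I_4}} :=
  let x1 := @Ordinal 4 0 isT in
  let x2 := @Ordinal 4 1 isT in
  let x3 := @Ordinal 4 2 isT in
  let x4 := @Ordinal 4 3 isT in
  [set [set x1; x2; x3]; [set x1; x2; x4]].

(* Main.v *)
Require Import Defs.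
From mathcomp Require Import all_boot all_order all_algebra.
From mathcomp Require Import zify lra.

Set Implicit Arguments.
Unset Strict Implicit.
Unset Printing Implicit Defensive.

Import Order.TTheory GRing.Theory Num.Theory.
Local Open Scope ring_scope.

(** A copy of D2 is a pair of triangles having a common pair (a, b) of vertices
    that are consecutive in clockwise order in both. So if m pairwise disjoint
    triples of positive integers, each of sum n, are taken as the clockwise
    gaps between the vertices of a triangle, then all the rotations of these m
    triangles form a D2-free family of m * n triangles: the gap from a to b
    determines the triple and the place in it, hence the third vertex.
    For n >= 9k + 6 the 3 x (2k+1) Kotzig array provides 2k + 1 such triples,
    which gives about 2n^2/9 > 3n^2/14 triangles. *)

Section GapTriangles.
Local Open Scope nat_scope.

Lemma cyc_lt3 n (a b c : 'I_n) :
  cyc_lt [:: a; b; c] = [|| a < b < c, b < c < a | c < a < b].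
Proof.
(* Rotation by 3 is the identity again, so the first disjunct comes up twice. *)
apply/existsP/idP => [[[[|[|[|[|k]]]] lt_k]] /=|]; rewrite ?andbT //.
- by move=> ->.
- by move=> ->; rewrite orbT.
- by move=> ->; rewrite !orbT.
- by move=> ->.
case/or3P => lt_abc.
- by exists (@Ordinal 4 0 isT); rewrite /= andbT.
- by exists (@Ordinal 4 1 isT); rewrite /= andbT.
- by exists (@Ordinal 4 2 isT); rewrite /= andbT.
Qed.

Definition gap n (a b : 'I_n) : nat := if a <= b then b - a else b + n - a.

Lemma gap_inj n (a : 'I_n) : injective (gap a).
Proof.
move=> b c; rewrite /gap => eq_g; apply: val_inj => /=.
have := ltn_ord a; have := ltn_ord b; have := ltn_ord c; move: eq_g.
by case: (leqP a b); case: (leqP a c); lia.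
Qed.

Definition shift n (x : 'I_n) (d : nat) : 'I_n :=
  Ordinal (ltn_pmod (x + d) (leq_ltn_trans (leq0n x) (ltn_ord x))).

Lemma shiftE n (x : 'I_n) d :
  d <= n -> shift x d = (if x + d < n then x + d else x + d - n) :> nat.
Proof.
move=> le_dn; have lt_xn := ltn_ord x; rewrite /=.
case: ltnP => lt_s; first by rewrite modn_small.
by rewrite -{1}(subnK lt_s) modnDr modn_small //; lia.
Qed.

Definition triangle n (x : 'I_n) (p q : nat) : {set 'I_n} :=
  [set x; shift x p; shift x (p + q)].

Lemma shift_gap n (x : 'I_n) p q r :
    0 < p -> 0 < q -> 0 < r -> p + q + r = n ->
  let y := shift x p in let z := shift x (p + q) in
  [/\ cyc_lt [:: x; y; z], gap x y = p, gap y z = q & gap z x = r].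
Proof.
move=> p_gt0 q_gt0 r_gt0 sum_n y z; rewrite cyc_lt3 /gap !shiftE; try lia.
have lt_xn := ltn_ord x; split; case: (ltnP (x + p) n); case: (ltnP (x + (p + q)) n);
  by move=> *; repeat case: ifP; lia.
Qed.

Lemma cyc_rot3 n (a b c x y z : 'I_n) :
    cyc_lt [:: a; b; c] -> cyc_lt [:: x; y; z] ->
    [set a; b; c] = [set x; y; z] ->
  [\/ [/\ a = x, b = y & c = z], [/\ a = y, b = z & c = x]
    | [/\ a = z, b = x & c = y]].
Proof.
rewrite !cyc_lt3 => lt_abc lt_xyz eq_set.
have vtx e : e \in [set a; b; c] -> [\/ e = x, e = y | e = z].
  by rewrite eq_set !inE -orbA => /or3P[] /eqP ->;
    [constructor 1 | constructor 2 | constructor 3].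
move: (vtx a) (vtx b) (vtx c); rewrite !inE !eqxx ?orbT {vtx eq_set}.
(* Of the 27 assignments, all but the three rotations repeat a vertex or reverse the orientation,
   against [lt_abc]. *)
do 3![case/(_ isT)=> ?]; subst a b c.
all: try by [constructor 1 | constructor 2 | constructor 3].
all: lia.
Qed.

(** Only the first case keeps the base vertex [a = x]: counting distinct triangles needs it there,
    and disjointness of the gaps rules out the other cases. *)
Lemma gap_triangle n (x a b c : 'I_n) (p q r : nat) :
    0 < p -> 0 < q -> 0 < r -> p + q + r = n ->
    cyc_lt [:: a; b; c] -> [set a; b; c] = triangle x p q ->
  [\/ [/\ gap a b = p, gap b c = q & a = x],
      gap a b = q /\ gap b c = r
    | gap a b = r /\ gap b c = p].
Proof.
move=> p_gt0 q_gt0 r_gt0 sum_n lt_abc.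
have [lt_x gp gq gr] := shift_gap x p_gt0 q_gt0 r_gt0 sum_n.
case/(cyc_rot3 lt_abc lt_x) => -[-> -> ->]; rewrite ?gp ?gq ?gr.
- exact: Or31.
- exact: Or32.
- exact: Or33.
Qed.

Lemma card_cyc3 n (a b c : 'I_n) : cyc_lt [:: a; b; c] -> #|[set a; b; c]| = 3.
Proof.
rewrite cyc_lt3 => lt_abc.
have [ab ac bc] : [/\ a != b, a != c & b != c] by split; apply/eqP => ?; subst; lia.
by rewrite -setUA cardsU1 cards2 !inE negb_or ab ac bc.
Qed.

Lemma ex_D2_gap_triples n m (p q r : 'I_m -> nat) :
    (forall t, [/\ 0 < p t, 0 < q t & 0 < r t]) ->
    (forall t, p t + q t + r t = n) ->
    injective p -> injective q -> injective r ->
    (forall t u, p t <> q u) -> (forall t u, p t <> r u) ->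
    (forall t u, q t <> r u) ->
  n * m <= ex_cgh n D2.
Proof.
move=> pos sum_n p_inj q_inj r_inj pq pr qr.
pose T (w : 'I_n * 'I_m) := triangle w.1 (p w.2) (q w.2).
have gapT a b c w : cyc_lt [:: a; b; c] -> [set a; b; c] = T w ->
    let t := w.2 in
    [\/ [/\ gap a b = p t, gap b c = q t & a = w.1],
        gap a b = q t /\ gap b c = r t | gap a b = r t /\ gap b c = p t].
  by case: (pos w.2) => p0 q0 r0; apply: gap_triangle.
have cycT w : exists b c,
    [/\ cyc_lt [:: w.1; b; c], gap w.1 b = p w.2 & [set w.1; b; c] = T w].
  case: (pos w.2) => p0 q0 r0.
  have [lt_w gp _ _] := shift_gap w.1 p0 q0 r0 (sum_n w.2).
  by exists (shift w.1 (p w.2)), (shift w.1 (p w.2 + q w.2)).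
have T_inj : injective T.
  move=> [x t] [y u] eqT; have [b [c [lt_x /= gp defT]]] := cycT (x, t).
  have [[]|[]|[]] /= := gapT _ _ _ (y, u) lt_x (etrans defT eqT); rewrite gp.
  - by move=> /p_inj -> _ ->.
  - by move/pq.
  - by move/pr.
pose H := [set T w | w : 'I_n * 'I_m].
have card_H : #|H| = n * m by rewrite card_imset // card_prod !card_ord.
rewrite -card_H; apply: leq_bigmax_cond; apply/andP; split.
  apply/'forall_implyP => _ /imsetP[w _ ->]; have [b [c [lt_w _ <-]]] := cycT w.
  by rewrite card_cyc3.
apply/existsP => -[f /and3P[/injectiveP f_inj /forallP f_cyc /forallP f_edge]].
have cyc_f i j k : cyc_lt [:: i; j; k] -> cyc_lt [:: f i; f j; f k].
  by have /forallP/(_ j)/forallP/(_ k)/implyP := f_cyc i.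
have edge_f i j k : [set i; j; k] \in D2 ->
    exists w, [set f i; f j; f k] = T w.
  move=> D2e; have /implyP/(_ D2e)/imsetP[w _ fE] := f_edge [set i; j; k].
  by exists w; rewrite -fE !imsetU !imset_set1.
move: edge_f cyc_f; rewrite /D2.
set x1 := Ordinal _; set x2 := Ordinal _; set x3 := Ordinal _.
set x4 := Ordinal _ => edge_f cyc_f.
have [w def_w] := edge_f x1 x2 x3 (set21 _ _).
have [v def_v] := edge_f x1 x2 x4 (set22 _ _).
have lt3 : cyc_lt [:: x1; x2; x3] by rewrite cyc_lt3.
have lt4 : cyc_lt [:: x1; x2; x4] by rewrite cyc_lt3.
(* The gap of the common side fixes the triple and the place in it, hence the next gap. Of the nine
   cases, the three with equal places follow by injectivity, the others contradict disjointness. *)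
suff /gap_inj/f_inj : gap (f x2) (f x3) = gap (f x2) (f x4) by [].
move: (gapT _ _ _ _ (cyc_f _ _ _ lt3) def_w) (gapT _ _ _ _ (cyc_f _ _ _ lt4) def_v).
case=> -[-> ->] => [_||]; case=> -[].
- by move=> /p_inj -> ->.
- by move/pq.
- by move/pr.
- by move/esym/pq.
- by move/q_inj=> -> ->.
- by move/qr.
- by move/esym/pr.
- by move/esym/qr.
- by move/r_inj=> -> ->.
Qed.

Lemma ex_D2_ge n k : 9 * k + 6 <= n -> n * k.*2.+1 <= ex_cgh n D2.
Proof.
move=> le_kn.
(* The first two rows of the Kotzig array; p i + q i takes each value from
   3k+3 to 5k+3 once, so the third gap is injective with values at least
   n - (5k+3) > 4k+2. *)
pose p (i : 'I_k.*2.+1) := i.+1.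
pose q (i : 'I_k.*2.+1) := if i <= k then 3 * k + 2 + i else k + 1 + i.
apply: (@ex_D2_gap_triples _ _ p q (fun i => n - (p i + q i))).
- move=> i; have := ltn_ord i; rewrite /p /q; case: (leqP i) => ? ?; split; lia.
- move=> i; have := ltn_ord i; rewrite /p /q; case: (leqP i); lia.
- by move=> i j; rewrite /p => -[] /val_inj.
- move=> i j; have := ltn_ord i; have := ltn_ord j; rewrite /q => ? ? eq_q.
  by apply: val_inj => /=; move: eq_q; case: (leqP i); case: (leqP j); lia.
- move=> i j; have := ltn_ord i; have := ltn_ord j; rewrite /p /q => ? ? eq_q.
  by apply: val_inj => /=; move: eq_q; case: (leqP i); case: (leqP j); lia.
(* [p] fills 1..2k+1, [q] fills 2k+2..4k+2, and [9 * k + 6 <= n] puts the third gap at 4k+3 or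
   more. *)
- by move=> i j; have := ltn_ord i; have := ltn_ord j; rewrite /p /q;
    case: (leqP j); lia.
- by move=> i j; have := ltn_ord i; have := ltn_ord j; rewrite /p /q;
    case: (leqP j); lia.
- by move=> i j; have := ltn_ord i; have := ltn_ord j; rewrite /p /q;
    case: (leqP i); case: (leqP j); lia.
Qed.

Lemma ex_D2_bin n : 3 * 'C(n, 2) <= 7 * ex_cgh n D2 + 21 * n.
Proof.
have bin2_le : 2 * 'C(n, 2) <= n * n.-1 by rewrite bin2; lia.
(* For small [n] the linear term suffices. Otherwise take the largest [k] with 9k+6 <= n: then 2k+1
   >= (2n-19)/9, and 14/9 > 3/2 while the linear loss 133/9 is below 21. *)
have [lt_n6 | le6n] := ltnP n 6; first by nia.
have := @ex_D2_ge n ((n - 6) %/ 9).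
have := divn_eq (n - 6) 9; have := ltn_pmod (n - 6) (isT : 0 < 9).
move: ((n - 6) %/ 9) (_ %% _) => k d lt_d def_n /(_ ltac:(lia)).
nia.
Qed.

End GapTriangles.

Theorem mainTheorem8 (R : realFieldType) :
  exists C : R, 0 < C /\
    forall n : nat, (3 <= n)%N ->
      3%:R / 7%:R * 'C(n, 2)%:R - C * n%:R <= (ex_cgh n D2)%:R.
Proof.
(* The constant is 21/7, from dividing the bound of [ex_D2_bin] by 7. *)
exists 3%:R; split=> [|n _]; first by rewrite ltr0n.
have := ex_D2_bin n; rewrite -(ler_nat R) natrD !natrM; lra.
Qed.
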